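(* Let $n,k,\lambda,\mu$ be integers. Suppose there exists a strongly regular graph with parameters $n,k,\lambda,\mu$. Define integers $c_0,c_1,c_2,\ldots$ by $c_0=n$, $c_1=0$, and for $\ell\ge 2$, \[ c_{\ell} \,=\, \mu n k^{\ell-2} + (\lambda-\mu)\, c_{\ell-1} + (k-\mu)\, c_{\ell-2}. \] Then every prime $p$ divides $c_p$.
   Context: A strongly regular graph with parameters $n,k,\lambda,\mu$ is a finite undirected graph $G$ (no loops or multiple edges) such that $G$ has $n$ vertices; $G$ is regular of degree $k$; every two adjacent vertices of $G$ have exactly $\lambda$ common neighbours; and every two distinct nonadjacent vertices of $G$ have exactly $\mu$ common neighbours. By convention, complete graphs and their complements are excluded, i.e. it is assumed that $0<k<n-1$. *)

(* Defs.v *)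
From mathcomp Require Import all_boot all_order all_algebra.

Set Implicit Arguments.
Unset Strict Implicit.
Unset Printing Implicit Defensive.

Import Order.TTheory GRing.Theory Num.Theory.
Local Open Scope ring_scope.

Definition common_neighbours (T : finType) (adj : rel T) (x y : T) : {set T} :=
  [set z | adj x z && adj y z].

(* The parameters are integers, so the cardinals are cast to int; in
   particular n - 1 below is not a truncated subtraction. *)
Record strongly_regular (T : finType) (adj : rel T)
    (n k lambda mu : int) : Prop := StronglyRegular {
  srg_sym : symmetric adj;
  srg_irrefl : irreflexive adj;
  srg_order : #|T|%:Z = n;
  srg_regular : forall x : T, #|[set y | adj x y]|%:Z = k;
  srg_adjacent : forall x y : T,
    adj x y -> #|common_neighbours adj x y|%:Z = lambda;
  srg_nonadjacent : forall x y : T,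
    x != y -> ~~ adj x y -> #|common_neighbours adj x y|%:Z = mu;
  srg_nontrivial : 0 < k < n - 1
}.

Fixpoint srg_seq (n k lambda mu : int) (l : nat) : int :=
  match l with
  | 0%N => n
  | 1%N => 0
  | (i.+1 as j).+1 =>
      mu * n * k ^+ i + (lambda - mu) * srg_seq n k lambda mu j
        + (k - mu) * srg_seq n k lambda mu i
  end.

(* Main.v *)
Require Import Defs.
From mathcomp Require Import all_boot all_order all_algebra.
From mathcomp Require Import ring.

(** Let A be the adjacency matrix and J the all-ones matrix. From
    A^2 = k + lambda A + mu (J - 1 - A) and A J = k J, the traces of the powers
    of A satisfy the recurrence defining c, so c_l = tr (A^l). It remains to see
    that tr (A^p) = (tr A)^p in characteristic p: there
    char_poly(A)(X)^p = det (X^p - A^p) = char_poly(A^p)(X^p), and the traces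
    are read off the coefficients of degree p (n - 1). *)

Set Implicit Arguments.
Unset Strict Implicit.
Unset Printing Implicit Defensive.

Import Order.TTheory GRing.Theory Num.Theory.
Local Open Scope ring_scope.

Lemma pchar_matrix (R : nzRingType) (n p : nat) :
  p \in [pchar R] -> p \in [pchar 'M[R]_n.+1].
Proof.
rewrite !inE => /andP[-> /eqP pR0] /=.
by rewrite -(rmorph_nat (@scalar_mx R n.+1)) pR0 raddf0.
Qed.

Lemma det_exp (R : comNzRingType) (n m : nat) (A : 'M[R]_n) :
  \det (A ^+ m) = \det A ^+ m.
Proof.
by elim: m => [|m IHm]; rewrite ?expr0 ?det1 // !exprS det_mulmx IHm.
Qed.

Lemma map_mx_exp (R S : pzRingType) (f : {rmorphism R -> S}) (n m : nat)
    (A : 'M[R]_n) :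
  map_mx f (A ^+ m) = map_mx f A ^+ m.
Proof. by elim: m => [|m IHm]; [exact: map_mx1 | rewrite !exprS map_mxM IHm]. Qed.

(** Frobenius is a ring morphism on [{poly R}]: it acts as Frobenius on constants and sends ['X] to
    ['X^p]. *)
Lemma polyX_pchar (R : comNzRingType) (p : nat) (pcharRp : p \in [pchar R])
    (q : {poly R}) :
  q ^+ p = map_poly (pFrobenius_aut pcharRp) q \Po 'X^p.
Proof.
have pcharPp : p \in [pchar {poly R}] by rewrite pchar_poly.
elim/poly_ind: q => [|q c IHq].
  by rewrite rmorph0 comp_poly0 expr0n -leqn0 leqNgt prime_gt0 ?(pcharf_prime pcharRp).
rewrite -(pFrobenius_autE pcharPp) rmorphD rmorphM /= !pFrobenius_autE IHq.
rewrite rmorphD rmorphM /= map_polyX map_polyC comp_polyD comp_polyM.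
by rewrite comp_polyX comp_polyC /= pFrobenius_autE rmorphXn.
Qed.

Lemma char_poly_exp_pchar (R : comNzRingType) (n p : nat) (A : 'M[R]_n.+1) :
  p \in [pchar R] -> char_poly A ^+ p = char_poly (A ^+ p) \Po 'X^p.
Proof.
move=> pcharRp; have pcharPp : p \in [pchar {poly R}] by rewrite pchar_poly.
have pcharMp := pchar_matrix n pcharPp.
rewrite /char_poly -det_exp -(det_map_mx (comp_poly 'X^p)); congr (\det _).
(* The matrix ring is not commutative, so [(X - A)^p = X^p - A^p] rests on the scalar matrix [X]
   commuting with [A]. *)
rewrite /char_poly_mx -(pFrobenius_autE pcharMp) pFrobenius_autB_comm; last first.
  by rewrite -comm_mxE; apply: comm_scalar_mx.
rewrite !pFrobenius_autE map_mxB map_scalar_mx /= comp_polyX -!rmorphXn /=.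
by congr (_ - _); apply/matrixP => i j; rewrite !mxE comp_polyC.
Qed.

Lemma mxtrace_exp_pchar (R : comNzRingType) (n p : nat) (A : 'M[R]_n) :
  p \in [pchar R] -> \tr (A ^+ p) = \tr A ^+ p.
Proof.
move=> pcharRp; have p_gt0 := prime_gt0 (pcharf_prime pcharRp).
case: n A => [|n] A; first by rewrite /mxtrace !big_ord0 expr0n -leqn0 leqNgt p_gt0.
(* The size is now [n.+1], so the coefficient of degree [n] of a characteristic polynomial is minus
   the trace; composition with ['X^p] moves it to degree [n * p]. *)
have := congr1 (fun q : {poly R} => q`_(n * p)) (char_poly_exp_pchar A pcharRp).
rewrite (polyX_pchar pcharRp) !coef_comp_poly_Xn // dvdn_mull // mulnK //.
rewrite coef_map -[n in X in X -> _]/n.+1.-1 !char_poly_trace //=.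
by rewrite rmorphN /= pFrobenius_autE => /oppr_inj.
Qed.

(** Reduction of the entries modulo [p] commutes with powers and traces, which moves the question to
    ['F_p]. *)
Lemma dvdz_mxtrace_exp (n p : nat) (A : 'M[int]_n) :
  prime p -> \tr A = 0 -> (p %| \tr (A ^+ p))%Z.
Proof.
move=> p_pr trA0; have pcharFp := pchar_Fp p_pr.
rewrite (dvdz_pcharf pcharFp) -(trace_map_mx intr).
rewrite map_mx_exp mxtrace_exp_pchar // trace_map_mx trA0 rmorph0 expr0n.
by rewrite -leqn0 leqNgt prime_gt0.
Qed.

(** Turns the entries of [A *m A] and [A *m J], sums of 0/1 indicators over ordinals, into the
    cardinals of the graph axioms. *)
Lemma sum_enum_val_mem (T : finType) (P : pred T) :
  \sum_(i < #|T|) (P (enum_val i))%:Z = #|[set x | P x]|%:Z.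
Proof.
rewrite -(big_enum_val (A := T) (fun x => (P x)%:Z)) /=.
rewrite cardsE -sum1_card -[RHS]natz natr_sum [RHS]big_mkcond /=.
by apply: eq_bigr => x _; rewrite -topredE /=; case: (P x).
Qed.

Definition adjmx (T : finType) (adj : rel T) : 'M[int]_#|T| :=
  \matrix_(i, j) (adj (enum_val i) (enum_val j))%:Z.

Section StronglyRegularTrace.

Variables (T : finType) (adj : rel T) (n k lambda mu : int).
Hypothesis srgG : strongly_regular adj n k lambda mu.

Local Notation A := (adjmx adj).
Local Notation J := (const_mx 1 : 'M[int]_#|T|).

Lemma mxtrace_adjmx : \tr A = 0.
Proof. by apply: big1 => i _; rewrite mxE (srg_irrefl srgG). Qed.

Lemma adjmx_sqr : A *m A = k%:M + lambda *: A + mu *: (J - 1%:M - A).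
Proof.
apply/matrixP => i j; rewrite !mxE.
(* By symmetry of [adj], each product of entries is the indicator of a common neighbour of the two
   vertices. *)
under eq_bigr => l _ do
  rewrite !mxE [adj (enum_val l) _](srg_sym srgG) -PoszM mulnb.
rewrite (sum_enum_val_mem
  (fun z => adj (enum_val i) z && adj (enum_val j) z)).
(* On the diagonal, the common neighbours of a vertex with itself are its [k] neighbours. *)
have [<-|neq_ij] := eqVneq i j.
  rewrite (srg_irrefl srgG) /= mulr1n.
  have -> : k + lambda * 0 + mu * (1 - 1 - 0) = k by ring.
  rewrite -(srg_regular srgG (enum_val i)).
  by congr Posz; apply: eq_card => z; rewrite !inE andbb.
have neq_v : enum_val i != enum_val j by rewrite (inj_eq enum_val_inj).
case: (boolP (adj (enum_val i) (enum_val j))) => [adj_ij|nadj_ij] /=.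
  by rewrite (srg_adjacent srgG adj_ij) mulr0n; ring.
by rewrite (srg_nonadjacent srgG neq_v nadj_ij) mulr0n; ring.
Qed.

(** By regularity all row sums of [A] are [k], so each column of [J] is an eigenvector. *)
Lemma adjmx_exp_const l : A ^+ l *m J = k ^+ l *: J.
Proof.
have AJ : A *m J = k *: J.
  apply/matrixP => i j; rewrite !mxE.
  under eq_bigr => m _ do rewrite !mxE mulr1.
  by rewrite sum_enum_val_mem (srg_regular srgG) mulr1.
elim: l => [|l IHl]; first by rewrite mul1mx scale1r.
by rewrite exprSr -mulmxA AJ -scalemxAr IHl scalerA exprS.
Qed.

Lemma mxtrace_adjmx_exp l : \tr (A ^+ l) = srg_seq n k lambda mu l.
Proof.
have trJ : \tr J = n.
  rewrite /mxtrace; under eq_bigr do rewrite mxE.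
  by rewrite sumr_const card_ord natz (srg_order srgG).
(* The recurrence has order two, so the induction carries two consecutive values. *)
suff: \tr (A ^+ l) = srg_seq n k lambda mu l /\
      \tr (A ^+ l.+1) = srg_seq n k lambda mu l.+1 by case.
elim: l => [|l [IHl IHl1]].
  by rewrite expr0 expr1 mxtrace1 natz (srg_order srgG) mxtrace_adjmx.
split=> //.
have -> : A ^+ l.+2 = (mu * k ^+ l) *: J + (lambda - mu) *: A ^+ l.+1
                      + (k - mu) *: A ^+ l.
  (* With the square on the right, its [J] term becomes [A ^+ l *m J], the source of [k ^+ l]. *)
  have -> : A ^+ l.+2 = A ^+ l *m (A *m A) by rewrite mulmxA !exprSr.
  rewrite [A ^+ l.+1]exprSr adjmx_sqr !mulmxDr mul_mx_scalar -!scalemxAr.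
  rewrite !mulmxBr adjmx_exp_const mulmx1 !scalerBl !scalerBr scalerA.
  by apply/matrixP => i j; rewrite !mxE; ring.
rewrite !mxtraceD !mxtraceZ IHl IHl1 trJ /=; ring.
Qed.

End StronglyRegularTrace.

Theorem theorem2 (n k lambda mu : int) :
  (exists (T : finType) (adj : rel T), strongly_regular adj n k lambda mu) ->
  forall p : nat, prime p -> (p%:Z %| srg_seq n k lambda mu p)%Z.
Proof.
move=> [T [adj srgG]] p p_pr; rewrite -(mxtrace_adjmx_exp srgG).
exact: dvdz_mxtrace_exp p_pr (mxtrace_adjmx srgG).
Qed.
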